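(* Let $n\geq1$ and let $X$ be a symmetric $2n\times 2n$ matrix with zero diagonal and off-diagonal coefficients $x_{i,j}\in\{\pm1\}$. For $1\leq i\leq 2n$ define $$\epsilon_i=\epsilon_i(X)=\prod_{j\neq i}x_{i,j}\ \prod_{1\leq s<t\leq 2n}x_{s,t}\in\{\pm1\}.$$ Then the sign $\epsilon_i$ is well-defined on the switching class: for every diagonal matrix $D$ with diagonal entries in $\{\pm1\}$ and every $i$, $\epsilon_i(DXD)=\epsilon_i(X)$. Moreover, the two subsets $R_+=\{i\mid\epsilon_i=1\}$ and $R_-=\{i\mid\epsilon_i=-1\}$ of the set of row indices $\{1,\dots,2n\}$ both have even cardinality.
   Context: A switching class is an equivalence class of symmetric matrices with zero diagonal and off-diagonal coefficients in $\{\pm1\}$ under the relation $X\sim D\,P^t\,X\,P\,D$ with $P$ a permutation matrix (relabeling of the rows) and $D$ a diagonal matrix with diagonal entries in $\{\pm1\}$ (switching). *)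

(* Defs.v *)
From mathcomp Require Import all_boot all_order all_algebra.

Set Implicit Arguments.
Unset Strict Implicit.
Unset Printing Implicit Defensive.

Import Order.TTheory GRing.Theory Num.Theory.
Local Open Scope ring_scope.

Definition is_sign (R : numDomainType) (x : R) : Prop := x = 1 \/ x = -1.

Definition sign_symmetric (R : numDomainType) (m : nat) (X : 'M[R]_m) : Prop :=
  [/\ X^T = X,
      forall i, X i i = 0
    & forall i j, i != j -> is_sign (X i j)].

Definition switching_mx (R : numDomainType) (m : nat) (D : 'M[R]_m) : Prop :=
  is_diag_mx D /\ forall i, is_sign (D i i).

Definition eps (R : numDomainType) (m : nat) (X : 'M[R]_m) (i : 'I_m) : R :=
  (\prod_(j < m | j != i) X i j)
  * (\prod_(s < m) \prod_(t < m | (s < t)%N) X s t).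

Definition Rplus (R : numDomainType) (m : nat) (X : 'M[R]_m) : {set 'I_m} :=
  [set i | eps X i == 1].

Definition Rminus (R : numDomainType) (m : nat) (X : 'M[R]_m) : {set 'I_m} :=
  [set i | eps X i == -1].

(* Main.v *)
Require Import Defs.
From mathcomp Require Import all_boot all_order all_algebra.

Set Implicit Arguments.
Unset Strict Implicit.
Unset Printing Implicit Defensive.

Import Order.TTheory GRing.Theory Num.Theory.
Local Open Scope ring_scope.

(** Write [Q i] for the product of the off-diagonal entries of row [i] and [P]
    for the product of the entries above the diagonal, so that
    [eps X i = Q i * P].
    Switching by [D = diag(d)] multiplies both [Q i] and [P] by the product of
    all the [d j], because each row has an odd number of off-diagonal entries.
    By symmetry the product of the [Q i] is [P ^ 2], so the product of all the
    [eps X i] is [P ^ (2 + 2 n) = 1]; it is also [(-1) ^ #|Rminus X|]. *)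

Lemma is_signM (R : numDomainType) (x y : R) :
  is_sign x -> is_sign y -> is_sign (x * y).
Proof.
by move=> [->|->] [->|->]; rewrite ?mul1r ?mulr1 ?mulrNN ?mulr1;
  [left|right|right|left].
Qed.

Lemma is_sign_prod (R : numDomainType) (I : Type) (r : seq I) (P : pred I)
    (F : I -> R) :
  (forall i, P i -> is_sign (F i)) -> is_sign (\prod_(i <- r | P i) F i).
Proof. by move=> hF; apply: big_ind => //; [left | exact: is_signM]. Qed.

Lemma is_sign_sqr (R : numDomainType) (x : R) : is_sign x -> x * x = 1.
Proof. by case=> ->; rewrite ?mulrNN mulr1. Qed.

Lemma is_sign_expr_even (R : numDomainType) (x : R) (k : nat) :
  is_sign x -> ~~ odd k -> x ^+ k = 1.
Proof.
move=> hx /even_halfK <-.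
by rewrite -mul2n exprM expr2 is_sign_sqr // expr1n.
Qed.

(** The ordered pairs with [t < s] are renamed by exchanging the two products. The lemma serves
    twice: for [F s t = d s], which counts how often each [d s] occurs, and for the entries of a
    symmetric matrix, where the two factors coincide. *)
Lemma prod_neq_ltn (R : comPzSemiRingType) (m : nat) (F : 'I_m -> 'I_m -> R) :
  \prod_(s < m) \prod_(t < m | t != s) F s t =
  (\prod_(s < m) \prod_(t < m | (s < t)%N) F s t) *
  (\prod_(s < m) \prod_(t < m | (s < t)%N) F t s).
Proof.
rewrite [X in _ * X](exchange_big_dep predT) //= -big_split /=.
apply: eq_bigr => s _; rewrite (bigID (fun t : 'I_m => (s < t)%N)) /=.
by congr (_ * _); apply: eq_bigl => t; rewrite -val_eqE /=; case: ltngtP.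
Qed.

(** The product has [m - 1] equal factors, an odd number. This is how evenness of [m] enters the
    switching invariance. *)
Lemma prod_row_sign (R : numDomainType) (m : nat) (i : 'I_m) (x : R) :
  is_sign x -> ~~ odd m -> \prod_(j < m | j != i) x = x.
Proof.
move=> hx em; rewrite prodr_const cardC1 card_ord.
have m_gt0 : (0 < m)%N := leq_ltn_trans (leq0n i) (ltn_ord i).
have om : odd m.-1 by rewrite -[odd _]negbK -oddS prednK.
(* Being odd, [m.-1] is positive: one factor [x] splits off and leaves an even power. *)
rewrite -[m.-1]prednK ?odd_gt0 // exprS is_sign_expr_even ?mulr1 //.
by rewrite -oddS prednK ?odd_gt0.
Qed.

Section Switching.
Variables (R : numDomainType) (m : nat).
Implicit Types (X D : 'M[R]_m).

Lemma is_sign_prod_ltn X :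
  (forall i j, i != j -> is_sign (X i j)) ->
  is_sign (\prod_(s < m) \prod_(t < m | (s < t)%N) X s t).
Proof.
move=> hX; apply: is_sign_prod => s _; apply: is_sign_prod => t lt_st.
by apply: hX; rewrite -val_eqE /= ltn_eqF.
Qed.

Lemma is_sign_eps X i : sign_symmetric X -> is_sign (eps X i).
Proof.
move=> [_ _ hX]; apply: is_signM.
  by apply: is_sign_prod => j; rewrite eq_sym; exact: hX.
exact: is_sign_prod_ltn.
Qed.

Lemma switching_mxE D X i j :
  switching_mx D -> (D *m X *m D) i j = D i i * D j j * X i j.
Proof.
move=> [/is_diag_mxP hD _].
have [d ->] : exists d, D = diag_mx d.
  exists (\row_k D k k); apply/matrixP => a b; rewrite !mxE.
  by case: (eqVneq a b) => [->|ab]; rewrite ?mulr1n // mulr0n hD.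
by rewrite mul_diag_mx mul_mx_diag !mxE !eqxx !mulr1n mulrAC.
Qed.

Lemma prod_row_switching (d : 'I_m -> R) i :
  (forall j, is_sign (d j)) -> ~~ odd m ->
  \prod_(j < m | j != i) (d i * d j) = \prod_(j < m) d j.
Proof.
by move=> hd em; rewrite big_split /= prod_row_sign // [RHS](bigD1 i).
Qed.

Lemma prod_ltn_switching (d : 'I_m -> R) :
  (forall j, is_sign (d j)) -> ~~ odd m ->
  \prod_(s < m) \prod_(t < m | (s < t)%N) (d s * d t) = \prod_(j < m) d j.
Proof.
move=> hd em; under eq_bigr => s _ do rewrite big_split /=.
(* Used backwards with [F] constant in [t]: the factors [d s] and [d t] over [s < t] become [d s]
   over all ordered pairs of distinct indices, so each [d s] occurs [m - 1] times. *)
rewrite big_split /= -(prod_neq_ltn (fun s _ => d s)).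
by apply: eq_bigr => s _; rewrite prod_row_sign.
Qed.

Lemma eps_switching X D i :
  ~~ odd m -> switching_mx D -> eps (D *m X *m D) i = eps X i.
Proof.
move=> em hD; have hd := hD.2; rewrite /eps.
pose d j := D j j; pose dd := \prod_(j < m) d j.
have -> : \prod_(j < m | j != i) (D *m X *m D) i j =
          dd * \prod_(j < m | j != i) X i j.
  rewrite /dd -(prod_row_switching i hd em) -big_split /=.
  by apply: eq_bigr => j _; rewrite switching_mxE.
have -> : \prod_(s < m) \prod_(t < m | (s < t)%N) (D *m X *m D) s t =
          dd * \prod_(s < m) \prod_(t < m | (s < t)%N) X s t.
  rewrite /dd -(prod_ltn_switching hd em) -big_split /=.
  apply: eq_bigr => s _; rewrite -big_split /=.
  by apply: eq_bigr => t _; rewrite switching_mxE.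
(* The row and the upper triangle each contribute one [dd], and [dd * dd = 1]. *)
rewrite mulrACA is_sign_sqr ?mul1r //.
by apply: is_sign_prod => j _; exact: hd.
Qed.

Lemma prod_eps X : ~~ odd m -> sign_symmetric X -> \prod_(i < m) eps X i = 1.
Proof.
move=> em [sX _ hX]; rewrite /eps big_split /= prod_neq_ltn.
have -> : \prod_(s < m) \prod_(t < m | (s < t)%N) X t s =
          \prod_(s < m) \prod_(t < m | (s < t)%N) X s t.
  by do 2!apply: eq_bigr => ? _; rewrite -[in LHS]sX mxE.
have hP : is_sign (\prod_(s < m) \prod_(t < m | (s < t)%N) X s t) by
  exact: is_sign_prod_ltn.
by rewrite prodr_const card_ord is_sign_sqr // is_sign_expr_even // mulr1.
Qed.

Lemma even_card_Rminus X : ~~ odd m -> sign_symmetric X -> ~~ odd #|Rminus X|.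
Proof.
move=> em hX; have := prod_eps em hX.
have -> : \prod_(i < m) eps X i = (-1) ^+ #|Rminus X|.
  rewrite (bigID (mem (Rminus X))) /= [X in _ * X]big1 ?mulr1 => [|i].
    by rewrite -prodr_const; apply: eq_bigr => i; rewrite inE => /eqP.
  by rewrite inE; case: (is_sign_eps i hX) => ->; rewrite ?eqxx.
(* An odd exponent would give [-1 = 1], impossible in a [numDomainType]. *)
by rewrite -signr_odd => /eqP; case: odd; rewrite // expr1 eqNr oner_eq0.
Qed.

Lemma Rplus_setC X : sign_symmetric X -> Rplus X = ~: Rminus X.
Proof.
move=> hX; apply/setP => i; rewrite !inE.
by case: (is_sign_eps i hX) => ->; rewrite eqxx 1?[1 == _]eq_sym eqNr oner_eq0.
Qed.

End Switching.

Theorem mainTheorem3 (R : numDomainType) (n : nat) (hn : (1 <= n)%N)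
    (X : 'M[R]_(2 * n)) (hX : sign_symmetric X) :
  [/\ forall i : 'I_(2 * n), is_sign (eps X i),
      forall D : 'M[R]_(2 * n), switching_mx D ->
        forall i : 'I_(2 * n), eps (D *m X *m D) i = eps X i,
      ~~ odd #|Rplus X|
    & ~~ odd #|Rminus X|].
Proof.
have e2n : ~~ odd (2 * n) by rewrite oddM.
have em := even_card_Rminus e2n hX.
split=> // [i|D hD i|]; first exact: is_sign_eps.
  exact: eps_switching.
(* [Rplus X] is the complement of a set of even size among [2 * n] indices. *)
move: e2n; rewrite -[X in odd X]card_ord -(cardsC (Rminus X)) oddD.
by rewrite (negbTE em) -Rplus_setC.
Qed.
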